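(* The set of six mutually orthogonal three-qubit stabilizer states $$\{|\psi_\mu\rangle\}_{\mu=1}^6=\{|+\rangle|1\rangle|0\rangle,\ |0\rangle|+\rangle|1\rangle,\ |1\rangle|0\rangle|+\rangle,\ |-\rangle|1\rangle|0\rangle,\ |0\rangle|-\rangle|1\rangle,\ |1\rangle|0\rangle|-\rangle\}$$ cannot be perfectly discriminated by stabilizer operations.
   Context: Here $|0\rangle,|1\rangle$ is the computational basis of $\mathbb{C}^2$ (stabilized by $Z$ and $-Z$ respectively) and $|\pm\rangle=\frac{1}{\sqrt2}(|0\rangle\pm|1\rangle)$ (stabilized by $\pm X$); juxtaposition denotes tensor product. Pauli and Clifford groups: $X,Y,Z$ are the single-qubit Pauli matrices; $\mathcal{P}_n=\langle X,Y,Z\rangle^{\otimes n}$ is the $n$-qubit Pauli group; the Clifford group is $\mathrm{Cl}_n=\{V\in U(2^n): V\mathcal{P}_nV^\dagger=\mathcal{P}_n\}$. A pure $n$-qubit stabilizer state is a state of the form $U|0\rangle^{\otimes n}$ (up to phase) with $U\in\mathrm{Cl}_n$; equivalently, a state uniquely determined (up to phase) by a subgroup $\mathcal{S}=\langle g_1,\dots,g_n\rangle\subset\mathcal{P}_n$ with $g|\psi\rangle=|\psi\rangle$ for all $g\in\mathcal{S}$. Stabilizer operations: a stabilizer operation is a finite, arbitrarily long sequence of steps, each of one of the following kinds: (1) appending ancillary qubits in computational basis states; (2) applying a Clifford unitary to the qubits currently present; (3) performing a projective measurement of a qubit in the computational basis. The choice of each step may depend adaptively on all previous measurement outcomes. Running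 a stabilizer operation produces a classical record $\boldsymbol a$ of all measurement outcomes. Perfect discrimination: a set $\{|\psi_\mu\rangle\}_\mu$ can be perfectly discriminated by stabilizer operations if there are a stabilizer operation and a function $g$ from records to labels such that, for every $\mu$, when the input is (a single copy of) $|\psi_\mu\rangle$, the record $\boldsymbol a$ satisfies $g(\boldsymbol a)=\mu$ with probability $1$. *)

(* Defs.v *)
From mathcomp Require Import all_boot all_order all_algebra.
From mathcomp Require Import spectral sesquilinear.
From mathcomp Require Import mxtens complex.
From mathcomp Require Import classical_sets reals.

Set Implicit Arguments.
Unset Strict Implicit.
Unset Printing Implicit Defensive.

Import Order.TTheory GRing.Theory Num.Theory.
Local Open Scope ring_scope.
Local Open Scope sesquilinear_scope.
Local Open Scope classical_set_scope.

(* [qdim n] is 2 ^ n (see [qdimE]). The recursive form makes [qdim n.+1]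
   convertible to [qdim n * 2], the dimension produced by the Kronecker product
   [*t], so that adding a qubit on the right needs no cast. *)
Fixpoint qdim (n : nat) : nat := if n is m.+1 then (qdim m * 2)%N else 1%N.

Lemma qdimE n : qdim n = (2 ^ n)%N.
Proof. by elim: n => //= n ->; rewrite expnSr. Qed.

Section Stabilizer.
Variable C : numClosedFieldType.

Definition ket (b : bool) : 'cV[C]_2 := \col_i (i == b :> nat)%:R.
Definition ket_plus : 'cV[C]_2 := (sqrtC 2)^-1 *: (ket false + ket true).
Definition ket_minus : 'cV[C]_2 := (sqrtC 2)^-1 *: (ket false - ket true).

Definition mx2 (a b c d : C) : 'M[C]_2 :=
  \matrix_(i, j) if i == 0 then (if j == 0 then a else b)
                 else (if j == 0 then c else d).

Definition pauliX : 'M[C]_2 := mx2 0 1 1 0.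
Definition pauliY : 'M[C]_2 := mx2 0 (- 'i) 'i 0.
Definition pauliZ : 'M[C]_2 := mx2 1 0 0 (- 1).

(* v_0 (x) ... (x) v_(n-1), with qubit 0 as the leftmost factor. *)
Fixpoint ket_tensor n : ('I_n -> 'cV[C]_2) -> 'cV[C]_(qdim n) :=
  match n with
  | 0 => fun _ => 1%:M
  | m.+1 => fun v =>
      ket_tensor (fun i : 'I_m => v (widen_ord (leqnSn m) i)) *t v ord_max
  end.

Fixpoint op_tensor n : ('I_n -> 'M[C]_2) -> 'M[C]_(qdim n) :=
  match n with
  | 0 => fun _ => 1%:M
  | m.+1 => fun A =>
      op_tensor (fun i : 'I_m => A (widen_ord (leqnSn m) i)) *t A ord_max
  end.

(* The matrix group <X, Y, Z>. *)
Inductive pauli1 : 'M[C]_2 -> Prop :=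
| pauli1_1 : pauli1 1%:M
| pauli1_X : pauli1 pauliX
| pauli1_Y : pauli1 pauliY
| pauli1_Z : pauli1 pauliZ
| pauli1_mul A B : pauli1 A -> pauli1 B -> pauli1 (A *m B)
| pauli1_inv A : pauli1 A -> pauli1 (invmx A).

Definition pauli_group n : set 'M[C]_(qdim n) :=
  [set op_tensor A | A in [set A : 'I_n -> 'M[C]_2 | forall i, pauli1 (A i)]].
Arguments pauli_group n : clear implicits.

Definition clifford n (V : 'M[C]_(qdim n)) : Prop :=
  V \is unitarymx /\
  [set V *m P *m V^t* | P in pauli_group n] = pauli_group n.

Definition stabilizer_state n (psi : 'cV[C]_(qdim n)) : Prop :=
  exists (U : 'M[C]_(qdim n)) (c : C),
    [/\ clifford U, `|c| = 1
      & psi = c *: (U *m ket_tensor (fun _ => ket false))].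

Definition zproj n (i : 'I_n) (b : bool) : 'M[C]_(qdim n) :=
  op_tensor (fun j => if j == i then ket b *m (ket b)^t* else 1%:M).

Definition born n (i : 'I_n) (psi : 'cV[C]_(qdim n)) (b : bool) : C :=
  (psi^t* *m zproj i b *m psi) 0 0.

(* The normalized state after outcome [b]; it is 0 when [b] has probability
   0. *)
Definition post_measure n (i : 'I_n) (psi : 'cV[C]_(qdim n)) (b : bool) :
    'cV[C]_(qdim n) :=
  (sqrtC (born i psi b))^-1 *: (zproj i b *m psi).

(* A stabilizer operation is a finite decision tree, indexed by the number of
   qubits currently present. Branching on each outcome makes every later step
   a function of all the previous outcomes. *)
Inductive stab_op : nat -> Type :=
| Stop n : stab_op n
| Append n (b : bool) of stab_op n.+1 : stab_op n
| Apply n (V : 'M[C]_(qdim n)) of clifford V & stab_op n : stab_op n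
| Measure n (i : 'I_n) of (bool -> stab_op n) : stab_op n.

(* [record_prob S psi E] is the probability that the record of outcomes (in
   chronological order) of [S] run on input [psi] satisfies [E]. *)
Fixpoint record_prob n (S : stab_op n) :
    'cV[C]_(qdim n) -> pred (seq bool) -> C :=
  match S in stab_op n return 'cV[C]_(qdim n) -> pred (seq bool) -> C with
  | Stop _ => fun _ E => (E [::])%:R
  | Append _ b S' => fun psi E => record_prob S' (psi *t ket b) E
  | Apply _ V _ S' => fun psi E => record_prob S' (V *m psi) E
  | Measure _ i S' => fun psi E =>
      \sum_(b : bool) born i psi b *
        record_prob (S' b) (post_measure i psi b) (fun a => E (b :: a))
  end.

Definition perfectly_discriminable n (L : eqType)
    (psi : L -> 'cV[C]_(qdim n)) : Prop :=
  exists (S : stab_op n) (g : seq bool -> L),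
    forall mu, record_prob S (psi mu) (fun a => g a == mu) = 1.

Definition mutually_orthogonal n (L : eqType)
    (psi : L -> 'cV[C]_(qdim n)) : Prop :=
  forall mu nu, mu != nu -> (psi mu)^t* *m psi nu = 0.

Definition ket3 (u v w : 'cV[C]_2) : 'cV[C]_(qdim 3) :=
  ket_tensor (tnth [tuple u; v; w]).

Definition six_states : 'I_6 -> 'cV[C]_(qdim 3) :=
  tnth [tuple ket3 ket_plus (ket true) (ket false);
              ket3 (ket false) ket_plus (ket true);
              ket3 (ket true) (ket false) ket_plus;
              ket3 ket_minus (ket true) (ket false);
              ket3 (ket false) ket_minus (ket true);
              ket3 (ket true) (ket false) ket_minus].

End Stabilizer.

(* Main.v *)
Require Import Defs.
From mathcomp Require Import all_boot all_order all_algebra.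
From mathcomp Require Import spectral sesquilinear.
From mathcomp Require Import mxtens complex.
From mathcomp Require Import ring.
From mathcomp Require Import classical_sets reals.

Set Implicit Arguments.
Unset Strict Implicit.
Unset Printing Implicit Defensive.

Import Order.TTheory GRing.Theory Num.Theory.
Local Open Scope ring_scope.
Local Open Scope sesquilinear_scope.

(* Along any branch of a stabilizer operation, as long as no information about
   the input has been extracted, the Kraus operator is (up to scaling) an
   isometry [K] such that every Pauli [Q] on the current qubits satisfies
   [K^* Q K = 0] or [Q K = w K P] for a Pauli [P] on the input. When a qubit is
   measured, take [Q] to be its [Z]. In the first case the outcome is a fair
   coin and the property persists; if [P] is scalar the outcome is
   deterministic. Otherwise [P] is effectively measured on the input, and for
   the six states every nonscalar Pauli has a nonzero matrix element between
   two distinct states, which therefore become nonorthogonal in some branch and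
   can no longer be told apart. *)

(** * Tensor products *)

Section MatrixBasics.
Variable C : numClosedFieldType.

Lemma adjmxM m n p (A : 'M[C]_(m, n)) (B : 'M[C]_(n, p)) :
  (A *m B)^t* = B^t* *m A^t*.
Proof. by rewrite trmx_mul map_mxM. Qed.

Lemma adjmxZ m n (a : C) (A : 'M[C]_(m, n)) : (a *: A)^t* = a^* *: A^t*.
Proof. by apply/matrixP=> i j; rewrite !mxE rmorphM. Qed.

Lemma adjmx1 n : (1%:M : 'M[C]_n)^t* = 1%:M.
Proof. by rewrite trmx1 map_mx1. Qed.

Lemma adjmx0 m n : (0 : 'M[C]_(m, n))^t* = 0.
Proof. by rewrite trmx0 map_mx0. Qed.

Lemma adjmxT m n p q (A : 'M[C]_(m, n)) (B : 'M[C]_(p, q)) :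
  (A *t B)^t* = A^t* *t B^t*.
Proof. by rewrite trmx_tens map_mxT. Qed.

Lemma unitarymx_adjK n (U : 'M[C]_n) : U \is unitarymx -> U^t* *m U = 1%:M.
Proof. by move=> /unitarymxP/mulmx1C. Qed.

Lemma tensmx11 m n : (1%:M : 'M[C]_m) *t (1%:M : 'M[C]_n) = 1%:M.
Proof.
apply/matrixP=> i j; case: (mxtens_indexP i)=> i0 i1.
case: (mxtens_indexP j)=> j0 j1; rewrite tensmxE !mxE -natrM mulnb.
by rewrite (can_eq (@mxtens_indexK _ _)) xpair_eqE.
Qed.

Lemma tensmxPl m n p q (a b : C) (A B : 'M[C]_(m, n)) (M : 'M[C]_(p, q)) :
  (a *: A + b *: B) *t M = a *: (A *t M) + b *: (B *t M).
Proof. by apply/matrixP=> i j; rewrite !mxE; ring. Qed.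

Lemma tensmxPr m n p q (a b : C) (A B : 'M[C]_(m, n)) (M : 'M[C]_(p, q)) :
  M *t (a *: A + b *: B) = a *: (M *t A) + b *: (M *t B).
Proof. by apply/matrixP=> i j; rewrite !mxE; ring. Qed.

Lemma tensmxZ m n p q (a b : C) (A : 'M[C]_(m, n)) (B : 'M[C]_(p, q)) :
  (a *: A) *t (b *: B) = (a * b) *: (A *t B).
Proof. by apply/matrixP=> i j; rewrite !mxE; ring. Qed.

(* [A *t v], with the column dimension [n * 1] replaced by [n]. *)
Definition tensv m n (A : 'M[C]_(m, n)) (v : 'cV[C]_2) : 'M[C]_(m * 2, n) :=
  \matrix_(i, j) (A (mxtens_unindex i).1 j * v (mxtens_unindex i).2 0).

Lemma tensvE m (A : 'cV[C]_m) v : A *t v = tensv A v.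
Proof. by apply/matrixP=> i j; rewrite !mxE !ord1. Qed.

Lemma sum_mxtens m n (F : 'I_(m * n) -> C) :
  \sum_k F k = \sum_i \sum_j F (mxtens_index (i, j)).
Proof.
rewrite pair_big /= (reindex (@mxtens_index m n)) /=; last first.
  exists (@mxtens_unindex m n) => k _;
    by rewrite (mxtens_indexK, mxtens_unindexK).
by apply: eq_bigr=> [[]].
Qed.

Lemma mulmx_tensv m n p (Q : 'M[C]_(p, m)) (B : 'M[C]_2)
    (A : 'M[C]_(m, n)) v :
  (Q *t B) *m tensv A v = tensv (Q *m A) (B *m v).
Proof.
apply/matrixP=> i j; rewrite !mxE sum_mxtens mulr_suml.
apply: eq_bigr=> k _; rewrite mulr_sumr; apply: eq_bigr=> l _.
by rewrite !mxE !mxtens_indexK /=; ring.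
Qed.

Lemma tensv_mulmx m n p (A : 'M[C]_(m, n)) (B : 'M[C]_(n, p)) v :
  tensv A v *m B = tensv (A *m B) v.
Proof.
apply/matrixP=> i j; rewrite !mxE mulr_suml.
by apply: eq_bigr=> k _; rewrite !mxE; ring.
Qed.

Lemma adj_tensv_mulmx m n p (A : 'M[C]_(m, n)) (B : 'M[C]_(m, p)) v w :
  (tensv A v)^t* *m tensv B w = (v^t* *m w) 0 0 *: (A^t* *m B).
Proof.
apply/matrixP=> i j; rewrite !mxE sum_mxtens mulrC mulr_suml.
apply: eq_bigr=> k _; rewrite mulr_sumr; apply: eq_bigr=> l _.
by rewrite !mxE !mxtens_indexK /= rmorphM /=; ring.
Qed.

Lemma tensvZ m n a (A : 'M[C]_(m, n)) v : tensv A (a *: v) = a *: tensv A v.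
Proof. by apply/matrixP=> i j; rewrite !mxE; ring. Qed.

(** * Tensor products with one factor per qubit *)

Lemma eq_op_tensor n (A B : 'I_n -> 'M[C]_2) :
  A =1 B -> op_tensor A = op_tensor B.
Proof.
elim: n A B => //= n IHn A B eqAB.
by rewrite eqAB (IHn _ _ (fun i => eqAB _)).
Qed.

Lemma eq_ket_tensor n (u v : 'I_n -> 'cV[C]_2) :
  u =1 v -> ket_tensor u = ket_tensor v.
Proof.
elim: n u v => //= n IHn u v equv.
by rewrite equv (IHn _ _ (fun i => equv _)).
Qed.

Lemma op_tensor1 n : op_tensor (fun _ : 'I_n => 1%:M : 'M[C]_2) = 1%:M.
Proof. by elim: n => //= n ->; rewrite tensmx11. Qed.

Lemma op_tensorM n (A B : 'I_n -> 'M[C]_2) :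
  op_tensor A *m op_tensor B = op_tensor (fun i => A i *m B i).
Proof.
elim: n A B => /= [|n IHn] A B; first by rewrite mulmx1.
by rewrite tensmx_mul IHn.
Qed.

Lemma op_tensor_adj n (A : 'I_n -> 'M[C]_2) :
  (op_tensor A)^t* = op_tensor (fun i => (A i)^t*).
Proof.
by elim: n A => /= [|n IHn] A; rewrite ?adjmx1 // adjmxT IHn.
Qed.

Lemma op_tensor_ket n (A : 'I_n -> 'M[C]_2) v :
  op_tensor A *m ket_tensor v = ket_tensor (fun i => A i *m v i).
Proof.
elim: n A v => /= [|n IHn] A v; first by rewrite mulmx1.
by rewrite (@tensmx_mul _ _ _ _ _ 1 1) IHn.
Qed.

(** Induction: [i] is the last factor or lies among the earlier ones, and [*t] is linear in each
    argument. Stated for three families that agree off [i], it serves both for linear combinations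
    and for extracting a scalar. *)
Lemma op_tensor_lin n (i : 'I_n) a b (A B D : 'I_n -> 'M[C]_2) :
    D i = a *: A i + b *: B i ->
    (forall j, j != i -> A j = D j /\ B j = D j) ->
  op_tensor D = a *: op_tensor A + b *: op_tensor B.
Proof.
elim: n i A B D => [[]//|n IHn] i A B D /= Di Dj.
have eq_init (F G : 'I_n.+1 -> 'M[C]_2) :
    (forall j, j != ord_max -> F j = G j) ->
  op_tensor (fun j : 'I_n => F (widen_ord (leqnSn n) j)) =
  op_tensor (fun j : 'I_n => G (widen_ord (leqnSn n) j)).
  move=> eqFG; apply: eq_op_tensor => j; apply: eqFG.
  by rewrite -val_eqE /= neq_ltn ltn_ord.
have [i_max|i_max] := eqVneq i ord_max.
  rewrite -i_max Di tensmxPr (eq_init A D) ?(eq_init B D) // => j;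
    by rewrite -i_max => /Dj[].
have lt_in : (i < n)%N.
  by rewrite ltn_neqAle -ltnS ltn_ord andbT.
have iE : i = widen_ord (leqnSn n) (Ordinal lt_in) by apply: val_inj.
rewrite (IHn (Ordinal lt_in) (fun j => A (widen_ord _ j))
  (fun j => B (widen_ord _ j))) -?iE //; last first.
  by move=> j ne_j; apply: Dj; rewrite -val_eqE.
have [-> ->] : A ord_max = D ord_max /\ B ord_max = D ord_max.
  by apply: Dj; rewrite eq_sym.
by rewrite tensmxPl.
Qed.

Lemma ket_tensor_dot n (u v : 'I_n -> 'cV[C]_2) :
  (ket_tensor u)^t* *m ket_tensor v
    = (\prod_i ((u i)^t* *m v i) 0 0)%:M :> 'M_1.
Proof.
elim: n u v => /= [|n IHn] u v; first by rewrite adjmx1 mulmx1 big_ord0.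
rewrite !tensvE adj_tensv_mulmx IHn big_ord_recr /=.
by rewrite scale_scalar_mx mulrC.
Qed.

(** [zproj] unfolds to an instance of this embedding, so identities between projections reduce to
    identities between 2 by 2 matrices. *)
Definition at_qubit n (i : 'I_n) (A : 'M[C]_2) : 'M[C]_(qdim n) :=
  op_tensor (fun j => if j == i then A else 1%:M).

Lemma at_qubit_lin n (i : 'I_n) a b A B :
  at_qubit i (a *: A + b *: B) = a *: at_qubit i A + b *: at_qubit i B.
Proof.
by apply: (@op_tensor_lin _ i) => [|j /negbTE->//]; rewrite eqxx.
Qed.

Lemma at_qubitM n (i : 'I_n) A B :
  at_qubit i A *m at_qubit i B = at_qubit i (A *m B).
Proof.
by rewrite op_tensorM; apply: eq_op_tensor => j; case: eqP; rewrite ?mulmx1.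
Qed.

Lemma at_qubit1 n (i : 'I_n) : at_qubit i 1%:M = 1%:M.
Proof.
by rewrite -[RHS]op_tensor1; apply: eq_op_tensor => j; case: eqP.
Qed.

Lemma at_qubit_adj n (i : 'I_n) A : (at_qubit i A)^t* = at_qubit i (A^t*).
Proof.
by rewrite op_tensor_adj; apply: eq_op_tensor => j; case: eqP;
  rewrite ?adjmx1.
Qed.

End MatrixBasics.

(** * Paulis and projections *)

Section Paulis.
Variable C : numClosedFieldType.
Local Notation X := (pauliX C).
Local Notation Y := (pauliY C).
Local Notation Z := (pauliZ C).

Lemma ord2P (i : 'I_2) : i = 0 \/ i = 1.
Proof. by case: i => -[|[|//]] lti; [left|right]; apply: val_inj. Qed.

Lemma mx2P (A B : 'M[C]_2) :
  A 0 0 = B 0 0 -> A 0 1 = B 0 1 -> A 1 0 = B 1 0 -> A 1 1 = B 1 1 -> A = B.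
Proof.
by move=> ? ? ? ?; apply/matrixP => i j; case: (ord2P i) (ord2P j) => -> [] ->.
Qed.

Definition col2 (a b : C) : 'cV[C]_2 := \col_i (if i == 0 then a else b).

Lemma col2P (u v : 'cV[C]_2) : u 0 0 = v 0 0 -> u 1 0 = v 1 0 -> u = v.
Proof. by move=> ? ?; apply/colP => i; case: (ord2P i) => ->. Qed.

Lemma mx2_scalar (a : C) : a%:M = mx2 a 0 0 a.
Proof. by apply: mx2P; rewrite !mxE. Qed.

Lemma mx2M (a b c d a' b' c' d' : C) :
  mx2 a b c d *m mx2 a' b' c' d' =
  mx2 (a * a' + b * c') (a * b' + b * d') (c * a' + d * c') (c * b' + d * d').
Proof. by apply: mx2P; rewrite !mxE !big_ord_recl big_ord0 !mxE /= addr0. Qed.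

Lemma mx2Z (e a b c d : C) :
  e *: mx2 a b c d = mx2 (e * a) (e * b) (e * c) (e * d).
Proof. by apply: mx2P; rewrite !mxE. Qed.

Lemma mx2D (a b c d a' b' c' d' : C) :
  mx2 a b c d + mx2 a' b' c' d' = mx2 (a + a') (b + b') (c + c') (d + d').
Proof. by apply: mx2P; rewrite !mxE. Qed.

Lemma mx2_adj (a b c d : C) : (mx2 a b c d)^t* = mx2 a^* c^* b^* d^*.
Proof. by apply: mx2P; rewrite !mxE. Qed.

Lemma mx2_col2 (a b c d x y : C) :
  mx2 a b c d *m col2 x y = col2 (a * x + b * y) (c * x + d * y).
Proof. by apply: col2P; rewrite !mxE !big_ord_recl big_ord0 !mxE /= addr0. Qed.

Lemma col2Z (e a b : C) : e *: col2 a b = col2 (e * a) (e * b).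
Proof. by apply: col2P; rewrite !mxE. Qed.

Lemma col2D (a b a' b' : C) : col2 a b + col2 a' b' = col2 (a + a') (b + b').
Proof. by apply: col2P; rewrite !mxE. Qed.

Lemma col2_dot (a b a' b' : C) :
  ((col2 a b)^t* *m col2 a' b') 0 0 = a^* * a' + b^* * b'.
Proof. by rewrite !mxE !big_ord_recl big_ord0 !mxE /= addr0. Qed.

Lemma col2_outer (a b a' b' : C) :
  col2 a b *m (col2 a' b')^t* = mx2 (a * a'^*) (a * b'^*) (b * a'^*) (b * b'^*).
Proof. by apply: mx2P; rewrite !mxE big_ord_recl big_ord0 !mxE /= addr0. Qed.

Lemma ketE b : ket C b = col2 (~~ b)%:R b%:R.
Proof. by apply: col2P; rewrite !mxE; case: b. Qed.

(* [Z ^ z *m X ^ x] *)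
Definition pauli_xz (x z : bool) : 'M[C]_2 :=
  if x then mx2 0 1 ((-1) ^+ z) 0 else mx2 1 0 0 ((-1) ^+ z).

Lemma pauli_xzM x z x' z' :
  pauli_xz x z *m pauli_xz x' z' =
  (-1) ^+ (x && z') *: pauli_xz (x (+) x') (z (+) z').
Proof.
by case: x z x' z' => [] [] [] [] /=; rewrite mx2M mx2Z; congr mx2; ring.
Qed.

(** Up to nonzero scalars the group is generated by X and Z, which commute up to sign. The phase is
    forgotten: later only relations up to scalars and the vanishing of matrix elements matter. *)
Lemma pauli1_xz (A : 'M[C]_2) : pauli1 A ->
  exists a x z, a != 0 /\ A = a *: pauli_xz x z.
Proof.
elim=> [||||_ _ _ [a [x [z [a0 ->]]]] _ [b [x' [z' [b0 ->]]]]
  |{}A _ [a [x [z [a0 ->]]]]].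
- exists 1, false, false; rewrite oner_neq0; split=> //.
  by rewrite mx2_scalar mx2Z; congr mx2; ring.
- exists 1, true, false; rewrite oner_neq0; split=> //.
  by rewrite mx2Z; congr mx2; ring.
- exists (- 'i), true, true; rewrite oppr_eq0 neq0Ci; split=> //.
  by rewrite mx2Z; congr mx2; ring.
- exists 1, false, true; rewrite oner_neq0; split=> //.
  by rewrite mx2Z; congr mx2; ring.
- exists (a * b * (-1) ^+ (x && z')), (x (+) x'), (z (+) z').
  rewrite !mulf_neq0 ?signr_eq0 //; split=> //.
  by rewrite -scalemxAl -scalemxAr pauli_xzM !scalerA.
(* [pauli_xz x z] squares to the sign [(-1) ^+ (x && z)], so [B] is the inverse of
   [a *: pauli_xz x z]. *)
pose B := (a^-1 * (-1) ^+ (x && z)) *: pauli_xz x z.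
have AB : (a *: pauli_xz x z) *m B = 1%:M.
  rewrite -scalemxAl -scalemxAr pauli_xzM !addbb !scalerA.
  rewrite mulrA divff // mul1r -expr2 sqrr_sign scale1r mx2_scalar.
  by congr mx2.
exists (a^-1 * (-1) ^+ (x && z)), x, z.
rewrite !mulf_neq0 ?invr_eq0 ?signr_eq0 //; split=> //.
by rewrite -[invmx _]mulmx1 -AB mulKmx //; case/mulmx1_unit: AB.
Qed.

Lemma pauli1_commZ (A : 'M[C]_2) : pauli1 A ->
  exists s : bool, A *m Z = (-1) ^+ s *: (Z *m A).
Proof.
move=> /pauli1_xz[a [x [z [_ ->]]]]; exists x.
rewrite -scalemxAl -scalemxAr; have -> : Z = pauli_xz false true by [].
rewrite !pauli_xzM andbT addbC addFb addTb addbT scale1r !scalerA mulrC.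
by [].
Qed.

(** Without an X component the Pauli is diagonal and the basis ket is an eigenvector; with one, the
    ket is flipped to the orthogonal one. This one-qubit dichotomy handles appended ancillas. *)
Lemma pauli1_ket (A : 'M[C]_2) b : pauli1 A ->
  (exists w, A *m ket C b = w *: ket C b) \/
  ((ket C b)^t* *m (A *m ket C b)) 0 0 = 0.
Proof.
move=> /pauli1_xz[a [x [z [_ ->]]]]; case: x; [right|left].
  rewrite ketE mx2Z mx2_col2 col2_dot rmorph_nat rmorph_nat.
  by case: b => /=; ring.
exists (a * (-1) ^+ (z && b)).
by rewrite ketE mx2Z mx2_col2 col2Z; case: z b => [] [] /=; congr col2; ring.
Qed.

Lemma pauli_groupM n (P Q : 'M[C]_(qdim n)) :
  pauli_group P -> pauli_group Q -> pauli_group (P *m Q).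
Proof.
move=> [A pA <-] [B pB <-]; rewrite op_tensorM.
by exists (fun i => A i *m B i) => //= i; apply: pauli1_mul.
Qed.

Lemma pauli_group_at n (i : 'I_n) (A : 'M[C]_2) :
  pauli1 A -> pauli_group (at_qubit i A).
Proof.
move=> pA; exists (fun j => if j == i then A else 1%:M) => //= j.
by case: ifP => _ //; apply: pauli1_1.
Qed.

Lemma pauli_group_commZ n (i : 'I_n) (Q : 'M[C]_(qdim n)) :
  pauli_group Q ->
  exists s : bool, Q *m at_qubit i Z = (-1) ^+ s *: (at_qubit i Z *m Q).
Proof.
move=> [A pA <-]; have [s eAZ] := pauli1_commZ (pA i); exists s.
(* The null second summand gives the claim the shape of linearity in the factor [i]; all other
   factors of [at_qubit i Z] are 1. *)
rewrite !op_tensorM -[RHS]addr0 -[0](scale0r (op_tensor (fun j =>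
  A j *m (if j == i then Z else 1%:M)))).
apply: (@op_tensor_lin _ _ i) => [|j /negbTE->].
  by rewrite eqxx eAZ scale0r addr0.
by rewrite mul1mx mulmx1.
Qed.

Lemma op_tensor_scalar n (A : 'I_n -> 'M[C]_2) :
  (forall i, exists w, A i = w%:M) -> exists w, op_tensor A = w%:M.
Proof.
elim: n A => /= [|n IHn] A sA; first by exists 1.
have [w ->] := IHn (fun i => A (widen_ord (leqnSn n) i)) (fun i => sA _).
have [v ->] := sA ord_max; exists (w * v).
by rewrite -scalemx1 -(scalemx1 _ v) tensmxZ tensmx11 scalemx1.
Qed.

(** These are the spectral projections of Z on qubit [i], so the effect of a measurement is governed
    by what [encoding] says about a single Pauli. *)
Lemma zprojE n (i : 'I_n) b :
  zproj C i b = 2^-1 *: (1%:M + (-1) ^+ b *: at_qubit i Z).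
Proof.
have -> : zproj C i b = at_qubit i (ket C b *m (ket C b)^t*) by [].
rewrite -(at_qubit1 C i) scalerDr scalerA -at_qubit_lin; congr at_qubit.
rewrite ketE col2_outer mx2_scalar !mx2Z mx2D !rmorph_nat.
by case: b => /=; congr mx2; field.
Qed.

Lemma at_qubitZZ n (i : 'I_n) : at_qubit i Z *m at_qubit i Z = 1%:M.
Proof.
rewrite at_qubitM -(at_qubit1 C i); congr at_qubit.
by rewrite mx2M mx2_scalar; congr mx2; ring.
Qed.

Lemma zproj_adj n (i : 'I_n) b : (zproj C i b)^t* = zproj C i b.
Proof. by rewrite at_qubit_adj adjmxM trmxCK. Qed.

Lemma zproj_idem n (i : 'I_n) b : zproj C i b *m zproj C i b = zproj C i b.
Proof.
rewrite at_qubitM; congr at_qubit.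
rewrite ketE col2_outer mx2M !rmorph_nat.
by case: b => /=; congr mx2; ring.
Qed.

Lemma zprojD n (i : 'I_n) : zproj C i false + zproj C i true = 1%:M.
Proof.
rewrite !zprojE -scalerDr expr0 expr1 scale1r scaleN1r addrACA subrr addr0.
by rewrite -mulr2n -scaler_nat scalerA mulVf ?scale1r // pnatr_eq0.
Qed.

Lemma zproj_orth n (i : 'I_n) b : zproj C i b *m zproj C i (~~ b) = 0.
Proof.
have zprojC : zproj C i (~~ b) = 1%:M - zproj C i b.
  by rewrite -(zprojD i); case: b; rewrite /= ?addrK // addrC addKr.
by rewrite zprojC mulmxBr mulmx1 zproj_idem subrr.
Qed.

End Paulis.

(** * Measurement statistics *)

Section Measurement.
Variable C : numClosedFieldType.

Definition sqn n (psi : 'cV[C]_n) : C := (psi^t* *m psi) 0 0.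

Lemma sqnE n (psi : 'cV[C]_n) : sqn psi = \sum_i `|psi i 0| ^+ 2.
Proof. by rewrite /sqn mxE; apply: eq_bigr => i _; rewrite !mxE normCKC. Qed.

Lemma sqn_ge0 n (psi : 'cV[C]_n) : 0 <= sqn psi.
Proof. by rewrite sqnE sumr_ge0 // => i _; rewrite exprn_ge0. Qed.

Lemma sqn_eq0 n (psi : 'cV[C]_n) : sqn psi = 0 -> psi = 0.
Proof.
rewrite sqnE => psi0; apply/colP => i; apply/eqP; rewrite mxE -normr_eq0.
rewrite -sqrf_eq0 (psumr_eq0P _ psi0) // => j _.
by rewrite exprn_ge0.
Qed.

Lemma sqn_tens n (psi : 'cV[C]_(qdim n)) b :
  sqn (psi *t ket C b : 'cV[C]_(qdim n.+1)) = sqn psi.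
Proof.
rewrite /sqn !tensvE adj_tensv_mulmx ketE col2_dot !rmorph_nat.
suff -> : ((~~ b)%:R * (~~ b)%:R + b%:R * b%:R : C) = 1 by rewrite scale1r.
by case: b => /=; ring.
Qed.

Lemma sqn_unitary n (U : 'M[C]_n) (psi : 'cV[C]_n) :
  U \is unitarymx -> sqn (U *m psi) = sqn psi.
Proof.
by move=> uU; rewrite /sqn adjmxM mulmxA -(mulmxA _ _ U) unitarymx_adjK ?mulmx1.
Qed.

Lemma bornE n (i : 'I_n) (psi : 'cV[C]_(qdim n)) b :
  born i psi b = sqn (zproj C i b *m psi).
Proof.
by rewrite /sqn adjmxM mulmxA zproj_adj -(mulmxA (psi^t*)) zproj_idem.
Qed.

Lemma born_ge0 n (i : 'I_n) (psi : 'cV[C]_(qdim n)) b : 0 <= born i psi b.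
Proof. by rewrite bornE sqn_ge0. Qed.

Lemma sum_born n (i : 'I_n) (psi : 'cV[C]_(qdim n)) :
  \sum_(b : bool) born i psi b = sqn psi.
Proof.
rewrite big_bool /born /sqn -[in RHS](mulmx1 (psi^t*)) -(zprojD C i).
by rewrite mulmxDr mulmxDl [RHS]mxE addrC.
Qed.

(** Left as a product because it is 1 for a possible outcome and, as [0^-1 = 0], 0 for an impossible
    one. *)
Lemma sqn_post n (i : 'I_n) (psi : 'cV[C]_(qdim n)) b :
  sqn (post_measure i psi b) = (born i psi b)^-1 * born i psi b.
Proof.
rewrite {1}/sqn adjmxZ -scalemxAl -scalemxAr scalerA mxE -/(sqn _) -bornE.
rewrite conj_Creal ?rpredV ?ger0_real ?sqrtC_ge0 ?born_ge0 //.
by rewrite -expr2 exprVn sqrtCK.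
Qed.

(** The hypothesis is an inequality so that the induction also covers the zero vector left by an
    impossible outcome. *)
Lemma record_prob_itv n (S : stab_op C n) psi E :
  sqn psi <= 1 -> 0 <= record_prob S psi E <= 1.
Proof.
elim: S psi E => {n} [n|n b S IH|n V [uV _] S IH|n i S IH] psi E psi1 /=.
- by case: (E _); rewrite lexx ler01.
- by apply: IH; rewrite sqn_tens.
- by apply: IH; rewrite sqn_unitary.
have rp b : 0 <= record_prob (S b) (post_measure i psi b)
    (fun a => E (b :: a)) <= 1.
  apply: IH; rewrite sqn_post.
  by have [->|/mulVf->] := eqVneq (born i psi b) 0; rewrite ?mulr0 ?ler01.
rewrite sumr_ge0 => [/=|b _].
  apply: le_trans psi1; rewrite -(sum_born i); apply: ler_sum => b _.
  by rewrite ler_piMr ?born_ge0 //; case/andP: (rp b).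
by rewrite mulr_ge0 ?born_ge0 //; case/andP: (rp b).
Qed.

(** An average of numbers between 0 and 1 equals 1 only if every term of positive weight does. *)
Lemma record_prob_measure1 n (i : 'I_n) (S : bool -> stab_op C n) psi E b :
    sqn psi = 1 -> record_prob (Measure i S) psi E = 1 ->
    born i psi b != 0 ->
  record_prob (S b) (post_measure i psi b) (fun a => E (b :: a)) = 1.
Proof.
move=> psi1 /= rp1 born_neq0; apply/eqP.
pose r b' := record_prob (S b') (post_measure i psi b') (fun a => E (b' :: a)).
have sum0 : \sum_(b' : bool) born i psi b' * (1 - r b') = 0.
  under eq_bigr do rewrite mulrBr mulr1.
  by rewrite sumrB sum_born psi1 rp1 subrr.
have ge0 b' : true -> 0 <= born i psi b' * (1 - r b').
  move=> _; rewrite mulr_ge0 ?born_ge0 // subr_ge0.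
  suff /andP[] : 0 <= r b' <= 1 by [].
  apply: record_prob_itv; rewrite sqn_post.
  have [->|/mulVf->//] := eqVneq (born i psi b') 0; by rewrite mulr0 ler01.
have /eqP := psumr_eq0P ge0 sum0 (i := b) isT.
by rewrite mulf_eq0 (negbTE born_neq0) subr_eq0 eq_sym.
Qed.

Lemma clifford_intertwine n (V Q : 'M[C]_(qdim n)) :
  clifford V -> pauli_group Q -> exists2 P, pauli_group P & Q *m V = V *m P.
Proof.
move=> [uV eqV]; rewrite -{1}eqV => -[P pP <-]; exists P => //.
by rewrite -mulmxA unitarymx_adjK ?mulmx1.
Qed.

(** The quantity is the inner product of the two projected vectors, so neither of them vanishes. *)
Lemma zproj_neq0_born n (i : 'I_n) (phi chi : 'cV[C]_(qdim n)) b :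
    phi^t* *m zproj C i b *m chi != 0 ->
  born i phi b != 0 /\ born i chi b != 0.
Proof.
move=> nz; split; apply: contra_neq nz; rewrite bornE => /sqn_eq0 z.
  by rewrite -[phi^t* *m _](trmxCK) adjmxM trmxCK zproj_adj z adjmx0 mul0mx.
by rewrite -mulmxA z mulmx0.
Qed.

Lemma post_measure_dot n (i : 'I_n) (phi chi : 'cV[C]_(qdim n)) b :
    phi^t* *m zproj C i b *m chi != 0 ->
  (post_measure i phi b)^t* *m post_measure i chi b != 0.
Proof.
move=> nz; have [phi0 chi0] := zproj_neq0_born nz.
rewrite adjmxZ -scalemxAl -scalemxAr scalerA adjmxM zproj_adj.
rewrite mulmxA -(mulmxA (phi^t*)) zproj_idem scaler_eq0 negb_or nz andbT.
by rewrite mulf_neq0 ?conjC_eq0 ?invr_eq0 ?sqrtC_eq0.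
Qed.

(** Induction on [S]: ancillas and unitaries preserve the overlap, and a measurement leaves a
    nonzero overlap in some branch that both states reach. At the end both states give the same
    record, which cannot satisfy both predicates. These vary in the induction because each outcome
    prefixes the record. *)
Lemma nonorthogonal_not_discriminable n (S : stab_op C n)
    (phi chi : 'cV[C]_(qdim n)) (E F : pred (seq bool)) :
    (forall a, E a -> ~~ F a) -> sqn phi = 1 -> sqn chi = 1 ->
    phi^t* *m chi != 0 ->
  record_prob S phi E = 1 -> record_prob S chi F = 1 -> False.
Proof.
elim: S phi chi E F => {n} [n|n b S IH|n V [uV _] S IH|n i S IH]
  phi chi E F EF phi1 chi1 nz /=.
- move=> /eqP; case: (E [::]) (EF [::]) => [/(_ isT)/negbTE-> _|_].
    by move=> /eqP; rewrite eq_sym oner_eq0.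
  by rewrite eq_sym oner_eq0.
- apply: IH EF _ _ _; rewrite ?sqn_tens //.
  rewrite !tensvE adj_tensv_mulmx scaler_eq0 negb_or nz andbT.
  rewrite ketE col2_dot !rmorph_nat; case: b => /=.
    by rewrite mulr0 add0r mulr1 oner_neq0.
  by rewrite mulr0 addr0 mulr1 oner_neq0.
- apply: IH EF _ _ _; rewrite ?sqn_unitary //.
  by rewrite adjmxM mulmxA -(mulmxA _ _ V) unitarymx_adjK ?mulmx1.
(* The projections sum to 1, so the two projected overlaps sum to the nonzero overlap of [phi] and
   [chi]. *)
have [b nzb] : exists b, phi^t* *m zproj C i b *m chi != 0.
  have [z|] := eqVneq (phi^t* *m zproj C i false *m chi) 0;
    last by exists false.
  exists true; apply: contra_neq nz => z'.
  by rewrite -[phi^t*]mulmx1 -(zprojD C i) mulmxDr mulmxDl z z' addr0.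
have [phi0 chi0] := zproj_neq0_born nzb.
move=> /(record_prob_measure1 phi1)/(_ phi0) rpE.
move=> /(record_prob_measure1 chi1)/(_ chi0); apply: IH rpE => //.
- by move=> a; apply: EF.
- by rewrite sqn_post mulVf.
- by rewrite sqn_post mulVf.
exact: post_measure_dot.
Qed.

End Measurement.

(** * Encodings *)

Section Encodings.
Variable C : numClosedFieldType.
Local Notation Z := (pauliZ C).

(* [K] is an isometry whose range is a stabilizer code with logical Paulis given
   by those of the [k] input qubits, up to scalars. *)
Definition encoding k n (K : 'M[C]_(qdim n, qdim k)) : Prop :=
  K^t* *m K = 1%:M /\
  forall Q, pauli_group Q ->
    K^t* *m Q *m K = 0 \/
    exists w P, pauli_group P /\ Q *m K = w *: (K *m P).

Lemma encoding1 k : encoding (1%:M : 'M[C]_(qdim k)).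
Proof.
split=> [|Q pQ]; first by rewrite adjmx1 mulmx1.
by right; exists 1, Q; rewrite scale1r mul1mx mulmx1.
Qed.

(** Conjugation by [V] turns a Pauli after the gate into a Pauli before it. *)
Lemma encoding_clifford k n (K : 'M[C]_(qdim n, qdim k)) V :
  clifford V -> encoding K -> encoding (V *m K).
Proof.
move=> cV [KK encK]; have VV := unitarymx_adjK (proj1 cV).
split=> [|Q /(clifford_intertwine cV)[P pP QV]].
  by rewrite adjmxM mulmxA -(mulmxA (K^t*)) VV mulmx1.
have [KPK|[w [P' [pP' PK]]]] := encK P pP; [left|right].
  by rewrite adjmxM -!mulmxA (mulmxA Q) QV -mulmxA (mulmxA (V^t*)) VV
    mul1mx mulmxA.
by exists w, P'; rewrite mulmxA QV -mulmxA PK -scalemxAr mulmxA.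
Qed.

(** A Pauli on [n.+1] qubits splits into one on the old qubits and one on the ancilla. If the latter
    flips the ket, the compression vanishes; otherwise it acts as a scalar and the dichotomy for [K]
    decides. *)
Lemma encoding_append k n (K : 'M[C]_(qdim n, qdim k)) b :
  encoding K ->
  encoding (tensv K (ket C b) : 'M[C]_(qdim n.+1, qdim k)).
Proof.
have ket1 : ((ket C b)^t* *m ket C b) 0 0 = 1.
  by rewrite ketE col2_dot !rmorph_nat; case: b => /=; ring.
move=> [KK encK]; split=> [|_ [A pA <-]].
  by rewrite adj_tensv_mulmx ket1 scale1r.
rewrite /= -mulmxA mulmx_tensv adj_tensv_mulmx.
have [[w ->]|->] := pauli1_ket b (pA ord_max); last first.
  by left; rewrite scale0r.
have [|KQK|[v [P [pP ->]]]] :=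
  encK (op_tensor (fun i => A (widen_ord (leqnSn n) i))).
- by exists (fun i => A (widen_ord (leqnSn n) i)) => // i; apply: pA.
- by left; rewrite mulmxA KQK scaler0.
right; exists (w * v), P; split=> //.
by rewrite tensv_mulmx tensvZ -scalerA; congr (_ *: _);
  apply/matrixP => i j; rewrite !mxE mulrA.
Qed.

(* A Pauli [Q] anticommuting with [Z_i] is killed by the two projections; if it
   commutes, [Q] and [Z_i Q] agree up to sign on the projected space, so either
   of them may be used to move [Q] through [K]. *)
Lemma encoding_measure k n (K : 'M[C]_(qdim n, qdim k)) i b c :
    encoding K -> K^t* *m at_qubit i Z *m K = 0 -> c^* * c = 2 ->
  encoding (c *: (zproj C i b *m K)).
Proof.
move=> [KK encK] KZK cc; set Pi := zproj C i b.
have PiZ : at_qubit i Z *m Pi = (-1) ^+ b *: Pi.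
  rewrite /Pi zprojE -scalemxAr mulmxDr mulmx1 -scalemxAr at_qubitZZ.
  rewrite [RHS]scalerA mulrC -scalerA; congr (_ *: _).
  by rewrite scalerDr scalerA -expr2 sqrr_sign scale1r addrC.
have sandwich (Q : 'M[C]_(qdim n)) :
    (c *: (Pi *m K))^t* *m Q *m (c *: (Pi *m K))
    = 2 *: (K^t* *m (Pi *m Q *m Pi) *m K).
  rewrite adjmxZ -!scalemxAl -scalemxAr scalerA cc adjmxM zproj_adj.
  by rewrite !mulmxA.
split.
  (* The Z term of [Pi] compresses to 0, so the outcome has weight 1/2, which the squared modulus 2
     of [c] compensates. *)
  rewrite -[_^t*]mulmx1 sandwich mulmx1 zproj_idem /Pi zprojE.
  rewrite -scalemxAr -scalemxAl scalerA divff ?pnatr_eq0 // scale1r.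
  by rewrite mulmxDr mulmx1 mulmxDl KK -scalemxAr -scalemxAl KZK scaler0 addr0.
move=> Q pQ; have [s QZ] := pauli_group_commZ i pQ.
have QPi : Q *m Pi = zproj C i (b (+) s) *m Q.
  rewrite /Pi !zprojE -scalemxAl -scalemxAr mulmxDl mulmxDr mul1mx mulmx1.
  by rewrite -scalemxAr QZ scalerA -scalemxAl signr_addb.
case: s => [|] in QZ QPi *.
  left; rewrite sandwich -(mulmxA Pi) QPi (mulmxA Pi).
  by rewrite addbT zproj_orth mul0mx mulmx0 mul0mx scaler0.
rewrite addbF -/Pi in QPi.
have QPiPi : Q *m (c *: (Pi *m K)) = c *: (Pi *m (Q *m K)).
  by rewrite -scalemxAr (mulmxA Q) QPi -mulmxA.
have [KQK|[w [P [pP QK]]]] := encK Q pQ; last first.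
  right; exists w, P; split=> //.
  by rewrite QPiPi QK -scalemxAr -scalemxAl !scalerA mulrC mulmxA.
(* Here [Q] compresses to 0, so its product with Z on qubit [i] is tried. If that compresses to 0 as
   well, so does [Pi *m Q], which is half their signed sum. *)
have [KZQK|[w [P [pP ZQK]]]] :=
  encK (at_qubit i Z *m Q) (pauli_groupM (pauli_group_at i (@pauli1_Z C)) pQ).
  left; rewrite sandwich -(mulmxA Pi) QPi (mulmxA Pi) zproj_idem /Pi zprojE.
  rewrite -scalemxAl mulmxDl mul1mx -scalemxAl -scalemxAr mulmxDr -scalemxAr.
  by rewrite -scalemxAl mulmxDl KQK -scalemxAl KZQK scaler0 addr0 !scaler0.
(* [Pi] absorbs Z on qubit [i] up to the sign [(-1) ^+ b], so next to [Pi] the product may replace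
   [Q]. *)
right; exists ((-1) ^+ b * w), P; split=> //.
have PiZ' : Pi *m at_qubit i Z = (-1) ^+ b *: Pi.
  have := congr1 (fun M => M^t*) PiZ; rewrite adjmxM adjmxZ zproj_adj.
  rewrite at_qubit_adj rmorph_sign.
  by rewrite mx2_adj rmorph0 rmorph1 rmorphN1.
have PiE : Pi = (-1) ^+ b *: (Pi *m at_qubit i Z).
  by rewrite PiZ' scalerA -expr2 sqrr_sign scale1r.
rewrite QPiPi [in LHS]PiE -scalemxAl -mulmxA -scalemxAl -mulmxA (mulmxA _ Q).
by rewrite ZQK -scalemxAr !scalerA; congr (_ *: _); ring.
Qed.

(** Induction on [S] with [K] and [g] varying: a branch that has learnt nothing so far is described
    by an encoding. A measurement either reveals nothing and yields a new encoding, or leads to two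
    nonorthogonal states, which the remaining steps cannot separate. *)
Lemma encoding_not_discriminable k n (L : eqType)
    (psi : L -> 'cV[C]_(qdim k)) (mu0 mu1 : L)
    (K : 'M[C]_(qdim n, qdim k)) (S : stab_op C n) (g : seq bool -> L) :
    (forall mu, sqn (psi mu) = 1) -> mu0 != mu1 ->
    (forall P : 'M[C]_(qdim k), pauli_group P -> (exists w, P = w%:M) \/
      exists mu nu, mu != nu /\ (psi mu)^t* *m P *m psi nu != 0) ->
    encoding K ->
  ~ forall mu, record_prob S (K *m psi mu) (fun a => g a == mu) = 1.
Proof.
move=> psi1 mu01 nonloc.
have sqnK m (V : 'M[C]_(qdim m, qdim k)) mu :
    encoding V -> sqn (V *m psi mu) = 1.
  case=> VV _; rewrite /sqn adjmxM mulmxA -(mulmxA _ _ V) VV mulmx1.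
  exact: psi1.
elim: S K g => {n} [n|n b S IH|n V cV S IH|n i S IH] K g encK /= rp.
(* With no step left the record is empty, and [g [::]] cannot equal both [mu0] and [mu1]. *)
- have := rp mu1; have := rp mu0; case: eqP => [->|_ /eqP]; last first.
    by rewrite eq_sym oner_eq0.
  by rewrite (negbTE mu01) => _ /eqP; rewrite eq_sym oner_eq0.
- apply: (IH (tensv K (ket C b)) g (encoding_append b encK)) => mu.
  by rewrite -(rp mu) tensvE tensv_mulmx.
- apply: (IH (V *m K) g (encoding_clifford cV encK)) => mu.
  by rewrite -mulmxA.
have rp1 mu b := @record_prob_measure1 _ _ i S _ (fun a => g a == mu) b
  (sqnK _ _ mu encK) (rp mu).
have [KZK|[w [P [pP ZK]]]] :=
    (proj2 encK) _ (pauli_group_at i (@pauli1_Z C)).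
  (* Fair coin: the outcome is independent of the input, and following the branch [true] is enough
     for a contradiction. *)
  have born2 mu : born i (K *m psi mu) true = 2^-1.
    rewrite /born zprojE -scalemxAr -scalemxAl mxE.
    rewrite mulmxDr mulmx1 mulmxDl adjmxM -!mulmxA (mulmxA (K^t*)).
    rewrite (proj1 encK) mul1mx -scalemxAl -!scalemxAr !mulmxA.
    rewrite -(mulmxA _ (K^t*)) -(mulmxA _ _ K) KZK mulmx0 mul0mx scaler0 addr0.
    by rewrite -/(sqn _) psi1 mulr1.
  (* This [c] is the normalization in [post_measure] for an outcome of probability 1/2. *)
  have encK' := encoding_measure true (c := (sqrtC 2^-1)^-1) encK KZK.
  apply: (IH true _ (fun a => g (true :: a)) (encK' _)) => [|mu].
    rewrite conj_Creal ?rpredV ?ger0_real ?sqrtC_ge0 ?invr_ge0 ?ler0n //.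
    by rewrite -expr2 exprVn sqrtCK invrK.
  apply: etrans (rp1 mu true _); last by rewrite born2 invr_eq0 pnatr_eq0.
  by rewrite /post_measure born2 -scalemxAl mulmxA.
have [[v Pv]|[mu [nu [munu nz]]]] := nonloc P pP.
  have [u ZK'] : exists u, at_qubit i Z *m K = u *: K.
    by exists (w * v); rewrite ZK Pv mul_mx_scalar scalerA.
  have phi_neq0 : K *m psi mu0 != 0.
    apply: contra_eq_neq (sqnK _ _ mu0 encK) => ->.
    by rewrite /sqn mulmx0 mxE eq_sym oner_neq0.
  (* Z squares to 1, hence so does its eigenvalue [u]; the outcome [b] with this sign is certain. *)
  have [b uE] : exists b : bool, u = (-1) ^+ b.
    have : (u ^+ 2 - 1) *: (K *m psi mu0) = 0.
      have Zphi : at_qubit i Z *m (K *m psi mu0) = u *: (K *m psi mu0).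
        by rewrite mulmxA ZK' scalemxAl.
      rewrite scalerBl scale1r expr2 -scalerA -Zphi scalemxAr -Zphi.
      by rewrite (mulmxA (at_qubit i Z) (at_qubit i Z)) at_qubitZZ mul1mx subrr.
    move/eqP; rewrite scaler_eq0 (negbTE phi_neq0) orbF subr_eq0 sqrf_eq1.
    by case/orP=> /eqP->; [exists false | exists true].
  have projK : zproj C i b *m K = K.
    rewrite zprojE -scalemxAl mulmxDl mul1mx -scalemxAl ZK' uE scalerA.
    rewrite -expr2 sqrr_sign scale1r -mulr2n -scaler_nat scalerA.
    by rewrite mulVf ?scale1r // pnatr_eq0.
  have born1 mu : born i (K *m psi mu) b = 1.
    by rewrite bornE mulmxA projK sqnK.
  apply: (IH b K (fun a => g (b :: a)) encK) => mu.
  apply: etrans (rp1 mu b _); last by rewrite born1 oner_neq0.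
  by rewrite /post_measure born1 sqrtC1 invr1 scale1r mulmxA projK.
(* Two states that already overlap are inseparable by the whole remaining operation; otherwise the
   measurement itself creates the overlap. *)
have [nz0|nz0] := eqVneq ((psi mu)^t* *m psi nu) 0; last first.
  apply: (@nonorthogonal_not_discriminable _ _ (Measure i S) (K *m psi mu)
    (K *m psi nu) (fun a => g a == mu) (fun a => g a == nu)) (rp mu) (rp nu).
  - by move=> a /eqP->.
  - exact: sqnK.
  - exact: sqnK.
  by rewrite adjmxM mulmxA -(mulmxA _ _ K) (proj1 encK) mulmx1.
have w_neq0 : w != 0.
  apply: contra_eq_neq (sqnK _ _ mu0 encK) => w0.
  rewrite -[K in K *m _]mul1mx -(at_qubitZZ C i) -(mulmxA _ _ K) ZK w0 scale0r.
  rewrite mulmx0 mul0mx.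
  by rewrite /sqn mulmx0 mxE eq_sym oner_neq0.
(* By orthogonality the identity term of the projection contributes nothing, which leaves [w / 2]
   times the nonzero matrix element of [P]. *)
have nzb : (K *m psi mu)^t* *m zproj C i false *m (K *m psi nu) != 0.
  have -> : (K *m psi mu)^t* *m zproj C i false *m (K *m psi nu) =
      (2^-1 * w) *: ((psi mu)^t* *m P *m psi nu).
    rewrite zprojE expr0 scale1r -scalemxAr -scalemxAl -[RHS]scalerA.
    congr (_ *: _); rewrite mulmxDr mulmx1 mulmxDl adjmxM -!mulmxA.
    rewrite (mulmxA (K^t*) K) (proj1 encK) mul1mx nz0 add0r.
    rewrite (mulmxA (at_qubit i Z) K) ZK -scalemxAl -!scalemxAr -!mulmxA.
    by rewrite (mulmxA (K^t*) K) (proj1 encK) mul1mx.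
  by rewrite scaler_eq0 negb_or nz mulf_neq0 ?invr_eq0 ?pnatr_eq0.
have [mu_neq0 nu_neq0] := zproj_neq0_born nzb.
apply: nonorthogonal_not_discriminable (rp1 mu false mu_neq0)
  (rp1 nu false nu_neq0).
- by move=> a /eqP->.
- by rewrite sqn_post mulVf.
- by rewrite sqn_post mulVf.
exact: post_measure_dot.
Qed.

End Encodings.

(** * The six states *)

Section SingleQubitCliffords.
Variable C : numClosedFieldType.
Local Notation X := (pauliX C).
Local Notation Y := (pauliY C).
Local Notation Z := (pauliZ C).
Local Notation r := ((sqrtC (2 : C))^-1).

(** Both directions of conjugation are recorded so that a tensor product of such gates maps the
    Pauli group onto itself, not merely into it. *)
Definition clifford1 (V : 'M[C]_2) : Prop :=
  V *m V^t* = 1%:M /\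
  forall A, pauli1 A -> pauli1 (V *m A *m V^t*) /\ pauli1 (V^t* *m A *m V).

Lemma pauli1_unitmx (A : 'M[C]_2) : pauli1 A -> A \in unitmx.
Proof.
have inv2 (B : 'M[C]_2) : B *m B = 1%:M -> B \in unitmx by case/mulmx1_unit.
elim=> [||||{}A B _ uA _ uB|{}A _ uA]; first exact: unitmx1.
- by apply: inv2; rewrite mx2M mx2_scalar; congr mx2; ring.
- apply: inv2; rewrite mx2M mx2_scalar.
  by rewrite !mulNr !mulrN -(expr2 'i) sqrCi opprK; congr mx2; ring.
- by apply: inv2; rewrite mx2M mx2_scalar; congr mx2; ring.
- by rewrite unitmx_mul uA.
by rewrite unitmx_inv.
Qed.

(** Conjugation by a self-adjoint involution respects products and inverses, so the generators
    suffice, and its two directions coincide. *)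
Lemma clifford1_gen (V : 'M[C]_2) : V^t* = V -> V *m V = 1%:M ->
  pauli1 (V *m X *m V) -> pauli1 (V *m Y *m V) -> pauli1 (V *m Z *m V) ->
  clifford1 V.
Proof.
move=> Vadj VV pX pY pZ; rewrite /clifford1 Vadj; split=> // A pA.
suff: pauli1 (V *m A *m V) by [].
elim: pA => [||||A1 A2 _ pA1 _ pA2|A1 pA1 IH] //.
- by rewrite mulmx1 VV; apply: pauli1_1.
- have -> : V *m (A1 *m A2) *m V = (V *m A1 *m V) *m (V *m A2 *m V).
    by rewrite -!mulmxA (mulmxA V V) VV mul1mx.
  exact: pauli1_mul.
have -> : V *m invmx A1 *m V = invmx (V *m A1 *m V); last exact: pauli1_inv.
have inv1 : (V *m A1 *m V) *m (V *m invmx A1 *m V) = 1%:M.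
  rewrite -!mulmxA (mulmxA V V) VV mul1mx (mulmxA A1) mulmxV ?mul1mx //.
  exact: pauli1_unitmx.
by rewrite -[invmx (V *m _ *m V)]mulmx1 -inv1 mulKmx //; case/mulmx1_unit: inv1.
Qed.

Lemma clifford1M (V W : 'M[C]_2) :
  clifford1 V -> clifford1 W -> clifford1 (V *m W).
Proof.
move=> [VV cV] [WW cW]; split=> [|A pA]; rewrite adjmxM.
  by rewrite -mulmxA (mulmxA W) WW mul1mx.
split.
  have := (cV _ (cW _ pA).1).1; by rewrite !mulmxA.
by have := (cW _ (cV _ pA).2).2; rewrite !mulmxA.
Qed.

Lemma clifford1_1 : clifford1 1%:M.
Proof.
apply: clifford1_gen; rewrite ?adjmx1 ?mulmx1 ?mul1mx //.
- exact: pauli1_X.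
- exact: pauli1_Y.
exact: pauli1_Z.
Qed.

Lemma clifford1_X : clifford1 X.
Proof.
apply: clifford1_gen; last first.
- by do !apply: pauli1_mul; constructor.
- by do !apply: pauli1_mul; constructor.
- by do !apply: pauli1_mul; constructor.
- by rewrite mx2M mx2_scalar; congr mx2; ring.
by rewrite mx2_adj rmorph0 rmorph1.
Qed.

Lemma invsqrt2_neq0 : r != 0.
Proof. by rewrite invr_eq0 sqrtC_eq0 pnatr_eq0. Qed.

Lemma invsqrt2_conj : r^* = r.
Proof. by rewrite conj_Creal // rpredV ger0_real // sqrtC_ge0 ler0n. Qed.

Lemma invsqrt2_sqr : r * r = 2^-1.
Proof. by rewrite -expr2 exprVn sqrtCK. Qed.

Definition hadamard : 'M[C]_2 := r *: mx2 1 1 1 (- 1).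

Lemma clifford1_hadamard : clifford1 hadamard.
Proof.
have conjH (A : 'M[C]_2) : hadamard *m A *m hadamard =
    2^-1 *: (mx2 1 1 1 (- 1) *m A *m mx2 1 1 1 (- 1)).
  by rewrite -!scalemxAl -scalemxAr scalerA invsqrt2_sqr.
apply: clifford1_gen.
- by rewrite adjmxZ mx2_adj rmorph1 rmorphN1 invsqrt2_conj.
- rewrite -[hadamard in hadamard *m _]mulmx1 conjH mulmx1 mx2M mx2Z mx2_scalar.
  by congr mx2; field.
- have -> : hadamard *m X *m hadamard = Z; last exact: pauli1_Z.
  by rewrite conjH !mx2M mx2Z; congr mx2; field.
(* The conjugate is [- Y], written as a product of generators to exhibit it in [pauli1]. *)
- have -> : hadamard *m Y *m hadamard = X *m Y *m X.
    by rewrite conjH !mx2M mx2Z; congr mx2; field.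
  by do !apply: pauli1_mul; constructor.
have -> : hadamard *m Z *m hadamard = X; last exact: pauli1_X.
by rewrite conjH !mx2M mx2Z; congr mx2; field.
Qed.

(** Conjugation acts factor by factor; a preimage of a Pauli comes from conjugating each factor
    backwards. *)
Lemma clifford_op_tensor n (V : 'I_n -> 'M[C]_2) :
  (forall i, clifford1 (V i)) -> clifford (op_tensor V).
Proof.
move=> cV; have VV i : (V i)^t* *m V i = 1%:M.
  by apply: mulmx1C; case: (cV i).
split.
  apply/unitarymxP; rewrite op_tensor_adj op_tensorM -[RHS]op_tensor1.
  by apply: eq_op_tensor => i; case: (cV i).
apply/seteqP; split=> [_ [_ [A pA <-] <-]|_ [A pA <-]].
  rewrite op_tensor_adj !op_tensorM.
  by exists (fun i => V i *m A i *m (V i)^t*) => //= i;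
    exact: ((cV i).2 _ (pA i)).1.
exists (op_tensor (fun i => (V i)^t* *m A i *m V i)).
  by exists (fun i => (V i)^t* *m A i *m V i) => //= i;
    exact: ((cV i).2 _ (pA i)).2.
rewrite op_tensor_adj !op_tensorM; apply: eq_op_tensor => i.
by rewrite !mulmxA (cV i).1 mul1mx -mulmxA (cV i).1 mulmx1.
Qed.

Lemma ket_plusE : ket_plus C = col2 r r.
Proof.
by rewrite /ket_plus !ketE col2D col2Z /=; congr col2; ring.
Qed.

Lemma ket_minusE : ket_minus C = col2 r (- r).
Proof.
by rewrite /ket_minus !ketE -scaleN1r col2Z col2D col2Z /=; congr col2; ring.
Qed.

Definition stabilizer1 (v : 'cV[C]_2) :=
  exists2 V, clifford1 V & v = V *m ket C false.

Lemma stabilizer1_ket b : stabilizer1 (ket C b).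
Proof.
case: b; last by exists 1%:M; [apply: clifford1_1 | rewrite mul1mx].
exists X; first exact: clifford1_X.
by rewrite !ketE mx2_col2; congr col2 => /=; ring.
Qed.

Lemma stabilizer1_plus : stabilizer1 (ket_plus C).
Proof.
exists hadamard; first exact: clifford1_hadamard.
by rewrite ket_plusE ketE /hadamard mx2Z mx2_col2; congr col2 => /=; ring.
Qed.

Lemma stabilizer1_minus : stabilizer1 (ket_minus C).
Proof.
exists (hadamard *m X).
  exact: clifford1M clifford1_hadamard clifford1_X.
by rewrite ket_minusE ketE /hadamard mx2Z mx2M mx2_col2; congr col2 => /=; ring.
Qed.

End SingleQubitCliffords.

(** * Inner products and Pauli matrix elements of the six states *)

Section SixStates.
Variable C : numClosedFieldType.
Local Notation r := ((sqrtC (2 : C))^-1).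

Lemma ket3_stabilizer (u v w : 'cV[C]_2) :
  stabilizer1 u -> stabilizer1 v -> stabilizer1 w ->
  stabilizer_state (ket3 u v w).
Proof.
move=> [U cU ->] [V cV ->] [W cW ->].
exists (op_tensor (tnth [tuple U; V; W])), 1.
rewrite normr1 scale1r; split=> //.
  by apply: clifford_op_tensor => -[[|[|[|//]]] lti]; rewrite (tnth_nth 0).
rewrite op_tensor_ket; apply: eq_ket_tensor => -[[|[|[|//]]] lti];
  by rewrite !(tnth_nth 0).
Qed.

Lemma six_states_stabilizer mu : stabilizer_state (six_states C mu).
Proof.
have pl := stabilizer1_plus C; have mi := stabilizer1_minus C.
have k0 := stabilizer1_ket C false; have k1 := stabilizer1_ket C true.
by case: mu => -[|[|[|[|[|[|//]]]]]] lti;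
  rewrite /six_states (tnth_nth 0); apply: ket3_stabilizer.
Qed.

Lemma ket3_dot (u v w u' v' w' : 'cV[C]_2) :
  (ket3 u v w)^t* *m ket3 u' v' w' =
  ((u^t* *m u') 0 0 * (v^t* *m v') 0 0 * (w^t* *m w') 0 0)%:M.
Proof.
rewrite ket_tensor_dot !big_ord_recl big_ord0 mulr1 mulrA.
by rewrite !(tnth_nth 0).
Qed.

Lemma ket3_sandwich (A : 'I_3 -> 'M[C]_2) (u v w u' v' w' : 'cV[C]_2) :
  (ket3 u v w)^t* *m op_tensor A *m ket3 u' v' w' =
  ((u^t* *m (A 0 *m u')) 0 0 * (v^t* *m (A 1 *m v')) 0 0
    * (w^t* *m (A 2 *m w')) 0 0)%:M.
Proof.
rewrite -mulmxA op_tensor_ket -ket3_dot; congr (_ *m _).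
apply: eq_ket_tensor => -[[|[|[|//]]] lti]; rewrite !(tnth_nth 0) /=;
  by congr (A _ *m _); apply: val_inj.
Qed.

Lemma ket_dot b b' : ((ket C b)^t* *m ket C b') 0 0 = (b == b')%:R.
Proof.
by rewrite !ketE col2_dot !rmorph_nat; case: b b' => [] [] /=; ring.
Qed.

Lemma plus_dot : ((ket_plus C)^t* *m ket_plus C) 0 0 = 1.
Proof. by rewrite ket_plusE col2_dot invsqrt2_conj invsqrt2_sqr; field. Qed.

Lemma minus_dot : ((ket_minus C)^t* *m ket_minus C) 0 0 = 1.
Proof.
by rewrite ket_minusE col2_dot rmorphN /= invsqrt2_conj mulrNN invsqrt2_sqr;
  field.
Qed.

Lemma plus_minus_dot : ((ket_plus C)^t* *m ket_minus C) 0 0 = 0.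
Proof. by rewrite ket_plusE ket_minusE col2_dot invsqrt2_conj; ring. Qed.

Lemma minus_plus_dot : ((ket_minus C)^t* *m ket_plus C) 0 0 = 0.
Proof.
by rewrite ket_plusE ket_minusE col2_dot rmorphN /= invsqrt2_conj; ring.
Qed.

Lemma six_states_orthogonal : mutually_orthogonal (six_states C).
Proof.
by case=> -[|[|[|[|[|[|//]]]]]] lti; case=> -[|[|[|[|[|[|//]]]]]] ltj //= _;
  rewrite /six_states !(tnth_nth 0) /= ket3_dot ?ket_dot ?plus_minus_dot
    ?minus_plus_dot /= ?(mulr0, mul0r) raddf0.
Qed.

Lemma six_states_unit mu : sqn (six_states C mu) = 1.
Proof.
by rewrite /sqn; case: mu => -[|[|[|[|[|[|//]]]]]] lti;
  rewrite /six_states !(tnth_nth 0) /= ket3_dot !ket_dot ?plus_dot ?minus_dot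
    /= !mulr1 mxE.
Qed.

Lemma neq0_sign (t e : C) : t != 0 -> e = t \/ e = - t -> e != 0.
Proof. by move=> t0 [] ->; rewrite ?oppr_eq0. Qed.

Lemma flip_neq0 a z b : a != 0 ->
  ((ket C b)^t* *m (a *: pauli_xz C true z *m ket C (~~ b))) 0 0 != 0.
Proof.
move=> /neq0_sign; apply; rewrite !ketE mx2Z mx2_col2 col2_dot !rmorph_nat.
by case: z b => [] [] /=; solve [left; ring | right; ring].
Qed.

Lemma diag_neq0 a z b : a != 0 ->
  ((ket C b)^t* *m (a *: pauli_xz C false z *m ket C b)) 0 0 != 0.
Proof.
move=> /neq0_sign; apply; rewrite !ketE mx2Z mx2_col2 col2_dot !rmorph_nat.
by case: z b => [] [] /=; solve [left; ring | right; ring].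
Qed.

(** Both amplitudes of the plus state are nonzero, and a Pauli only permutes them up to nonzero
    scalars. *)
Lemma ket_plus_neq0 a x z b : a != 0 ->
  ((ket C b)^t* *m (a *: pauli_xz C x z *m ket_plus C)) 0 0 != 0.
Proof.
move=> a0; apply: (neq0_sign (mulf_neq0 a0 (invsqrt2_neq0 C))).
rewrite ketE ket_plusE.
by case: x z b => [] [] [] /=; rewrite mx2Z mx2_col2 col2_dot !rmorph_nat /=;
  solve [left; ring | right; ring].
Qed.

Lemma plus_ket_neq0 a x z b : a != 0 ->
  ((ket_plus C)^t* *m (a *: pauli_xz C x z *m ket C b)) 0 0 != 0.
Proof.
move=> a0; apply: (neq0_sign (mulf_neq0 a0 (invsqrt2_neq0 C))).
rewrite ketE ket_plusE.
by case: x z b => [] [] [] /=; rewrite mx2Z mx2_col2 col2_dot !invsqrt2_conj;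
  solve [left; ring | right; ring].
Qed.

(** Z maps the minus state to the plus state. *)
Lemma plus_Z_minus_neq0 a : a != 0 ->
  ((ket_plus C)^t* *m (a *: pauli_xz C false true *m ket_minus C)) 0 0 != 0.
Proof.
rewrite ket_plusE ket_minusE mx2Z mx2_col2 col2_dot !invsqrt2_conj.
rewrite (_ : _ + _ = a * (2 * (r * r))); last by ring.
by rewrite invsqrt2_sqr divff ?mulr1 ?pnatr_eq0.
Qed.

(** An X component is detected by two states from different cyclic shifts, and a Z component of a
    diagonal Pauli by the plus and minus versions of one shift. *)
Lemma six_states_pauli (P : 'M[C]_(qdim 3)) : pauli_group P ->
  (exists w, P = w%:M) \/
  exists mu nu, mu != nu /\
    (six_states C mu)^t* *m P *m six_states C nu != 0.
Proof.
have neq0M (s t u : C) : s != 0 -> t != 0 -> u != 0 ->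
    ((s * t * u)%:M : 'M_1) != 0.
  move=> s0 t0 u0; apply/eqP => /matrixP/(_ 0 0); rewrite !mxE /= => /eqP.
  by rewrite !mulf_eq0 (negbTE s0) (negbTE t0) (negbTE u0).
case=> A pA <-.
have [a0 [x0 [z0 [a0n A0]]]] := pauli1_xz (pA 0).
have [a1 [x1 [z1 [a1n A1]]]] := pauli1_xz (pA 1).
have [a2 [x2 [z2 [a2n A2]]]] := pauli1_xz (pA 2).
have pair k l (ltk : (k < 6)%N) (ltl : (l < 6)%N) : k != l ->
    (six_states C (Ordinal ltk))^t* *m op_tensor A
      *m six_states C (Ordinal ltl) != 0 ->
    exists mu nu, mu != nu /\
    (six_states C mu)^t* *m op_tensor A *m six_states C nu != 0.
  by move=> kl nz; exists (Ordinal ltk), (Ordinal ltl).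
(* On qubit 0, states 1 and 2 carry opposite basis kets, which X exchanges. On each other qubit one
   of them carries the plus state and the other a basis ket, so any Pauli factor has a nonzero
   element there. Qubits 1 and 2 are treated alike with their own pairs. *)
case: x0 A0 => A0.
  right; apply: (pair 1 2 isT isT) => //.
  rewrite /six_states !(tnth_nth 0) /= ket3_sandwich A0 A1 A2.
  by apply: neq0M; [exact: (flip_neq0 _ false) | exact: plus_ket_neq0 |
    exact: ket_plus_neq0].
case: x1 A1 => A1.
  right; apply: (pair 0 2 isT isT) => //.
  rewrite /six_states !(tnth_nth 0) /= ket3_sandwich A0 A1 A2.
  by apply: neq0M; [exact: plus_ket_neq0 | exact: (flip_neq0 _ true) |
    exact: ket_plus_neq0].
case: x2 A2 => A2.
  right; apply: (pair 0 1 isT isT) => //.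
  rewrite /six_states !(tnth_nth 0) /= ket3_sandwich A0 A1 A2.
  by apply: neq0M; [exact: plus_ket_neq0 | exact: ket_plus_neq0 |
    exact: (flip_neq0 _ false)].
(* All factors are now diagonal. States [k] and [k + 3] differ only by plus versus minus on qubit
   [k], which Z exchanges; on the basis kets of the other qubits a diagonal factor has a nonzero
   expectation. *)
case: z0 A0 => A0.
  right; apply: (pair 0 3 isT isT) => //.
  rewrite /six_states !(tnth_nth 0) /= ket3_sandwich A0 A1 A2.
  by apply: neq0M; [exact: plus_Z_minus_neq0 | exact: diag_neq0 |
    exact: diag_neq0].
case: z1 A1 => A1.
  right; apply: (pair 1 4 isT isT) => //.
  rewrite /six_states !(tnth_nth 0) /= ket3_sandwich A0 A1 A2.
  by apply: neq0M; [exact: diag_neq0 | exact: plus_Z_minus_neq0 |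
    exact: diag_neq0].
case: z2 A2 => A2.
  right; apply: (pair 2 5 isT isT) => //.
  rewrite /six_states !(tnth_nth 0) /= ket3_sandwich A0 A1 A2.
  by apply: neq0M; [exact: diag_neq0 | exact: diag_neq0 |
    exact: plus_Z_minus_neq0].
(* No X or Z component is left, so each factor is a scalar. *)
left; apply: op_tensor_scalar => -[[|[|[|//]]] lti].
- exists a0; rewrite (_ : Ordinal lti = 0); last exact: val_inj.
  by rewrite A0 mx2_scalar mx2Z; congr mx2; ring.
- exists a1; rewrite (_ : Ordinal lti = 1); last exact: val_inj.
  by rewrite A1 mx2_scalar mx2Z; congr mx2; ring.
exists a2; rewrite (_ : Ordinal lti = 2); last exact: val_inj.
by rewrite A2 mx2_scalar mx2Z; congr mx2; ring.
Qed.

End SixStates.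

Theorem theorem1 (R : realType) :
  [/\ forall mu, stabilizer_state (six_states R[i] mu),
      mutually_orthogonal (six_states R[i])
    & ~ perfectly_discriminable (six_states R[i])].
Proof.
split.
- exact: six_states_stabilizer.
- exact: six_states_orthogonal.
move=> [S [g rp]].
(* Before the first step the encoding is the identity; [ord0] and [ord_max] serve as two distinct
   labels. *)
apply: (@encoding_not_discriminable _ 3 3 _ (six_states R[i]) ord0 ord_max
  1%:M S g).
- exact: six_states_unit.
- by [].
- exact: six_states_pauli.
- exact: encoding1.
by move=> mu; rewrite mul1mx.
Qed.
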